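(* Let $k\ge1$, $\mu\in(0,\tfrac12]$, and consider the Deffuant model on $\mathbb{Z}$ with opinion space $(\mathbb{R}^k,\lVert\cdot\rVert_2)$, convergence parameter $\mu$, confidence bound $\theta>0$ and i.i.d. initial opinions with common distribution $\nu=\mathcal{L}(\eta_0)$. If the set-valued map $\vartheta\mapsto\mathscr{D}_\vartheta(\nu)$ has no jump in $[\theta-\epsilon,\theta+\epsilon]$ for some $\epsilon>0$ (with $\epsilon<\theta$), i.e. is constant on this interval, then for all $t>0$ $$\operatorname{supp}_\theta(\eta_t)=\mathscr{D}_\theta(\nu).$$
   Context: Deffuant model on $\mathbb{Z}$: the graph has vertex set $\mathbb{Z}$ and edges $\langle v,v+1\rangle$, $v\in\mathbb{Z}$. At time $0$ the vertices hold i.i.d. opinions $\eta_0(v)\in\mathbb{R}^k$, distributed as $\eta_0$. The edges carry independent unit-rate Poisson processes, independent of the initial opinions. Opinions change only at Poisson events: if an event occurs on $\langle u,v\rangle$ at time $t$ and $a=\eta_{t-}(u)$, $b=\eta_{t-}(v)$ are the values just before, then, if $\lVert a-b\rVert_2\le\theta$, one sets $\eta_t(u)=a+\mu(b-a)$ and $\eta_t(v)=b+\mu(a-b)$; otherwise both stay unchanged. All other opinions are unaffected. $B[y,r]=\{x\in\mathbb{R}^k:\lVert x-y\rVert_2\le r\}$. The support of an $\mathbb{R}^k$-valued random variable $\zeta$ is $\operatorname{supp}(\zeta)=\{x\in\mathbb{R}^k:\mathbb{P}(\zeta\in B[x,r])>0\text{ for all }r>0\}$. $\operatorname{supp}_\theta(\eta_t)$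 denotes the support of the distribution of $\eta_t(v)$ (the same for all $v\in\mathbb{Z}$) in the model with confidence bound $\theta$. Finite configuration: an $n\in\mathbb{N}=\{1,2,\dots\}$ (representing the path $\{1,\dots,n\}$), values $x_1,\dots,x_n\in\operatorname{supp}(\eta_0)$, and a finite (possibly empty) sequence $(e_i)_{i=1}^N$ of edges from $\{\langle1,2\rangle,\dots,\langle n-1,n\rangle\}$. Updating it with respect to $\theta$ means starting from opinions $x_v$ at $v\in\{1,\dots,n\}$ and successively applying, for $i=1,\dots,N$, the map $T^\theta_{e_i}$, where for $e=\langle u,v\rangle$ the map $T^\theta_e$ replaces the pair of values $(\xi(u),\xi(v))$ by $((1-\mu)\xi(u)+\mu\xi(v),\ \mu\xi(u)+(1-\mu)\xi(v))$ if $\lVert\xi(u)-\xi(v)\rVert_2\le\theta$, and changes nothing otherwise. The outcome is denoted $\eta_N(1),\dots,\eta_N(n)$. For $\theta>0$, $\mathscr{D}_\theta(\nu)$ is the set of all $x\in\mathbb{R}^k$ such that for every $r>0$ there is a finite configuration which, updated with respect to $\theta$, yields $\eta_N(v)\in B[x,r]$ for all $v\in\{1,\dots,n\}$. *)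

(* Defs.v *)
From HB Require Import structures.
From mathcomp Require Import all_boot all_order all_algebra finmap.
From mathcomp Require Import all_classical all_reals all_analysis.

Set Implicit Arguments.
Unset Strict Implicit.
Unset Printing Implicit Defensive.
Import Order.TTheory GRing.Theory Num.Theory.
Import numFieldTopology.Exports numFieldNormedType.Exports.
Local Open Scope classical_set_scope.
Local Open Scope ring_scope.

Section Space.
Context {R : realType} {k : nat}.
Implicit Types (x y : 'rV[R]_k) (r : R).

(* The library norm on ['rV_k] is the sup norm, hence this definition.  The
   topology of ['rV_k] is the product one, i.e. the Euclidean topology. *)
Definition norm2 x : R := Num.sqrt (\sum_(i < k) x ord0 i ^+ 2).

Definition cball2 y r : set 'rV[R]_k := [set x | norm2 (x - y) <= r].

Definition supp (m : set 'rV[R]_k -> \bar R) : set 'rV[R]_k :=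
  [set x | forall r, 0 < r -> (0 < m (cball2 x r))%E].

End Space.

Notation borel_rV R k := (g_sigma_algebraType (@open 'rV[R]_k)).

Section Interaction.
Context {R : realType} {k : nat}.
Variables (mu theta : R).
Implicit Types (a b : 'rV[R]_k).

(* New opinion of an agent holding [a] after meeting one holding [b]; the
   other agent moves to [interact b a]. *)
Definition interact a b : 'rV[R]_k :=
  if norm2 (a - b) <= theta then a + mu *: (b - a) else a.

(* The map T_e for the edge e = <e, e + 1>. *)
Definition edge_update (xi : nat -> 'rV[R]_k) (e : nat) : nat -> 'rV[R]_k :=
  fun v => if v == e then interact (xi e) (xi e.+1)
           else if v == e.+1 then interact (xi e.+1) (xi e)
           else xi v.

End Interaction.

Section FiniteConfigurations.
Context {R : realType} {k : nat}.
Variables (mu : R) (nu : set 'rV[R]_k -> \bar R).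

(* The path has vertices 1, ..., n and [e] stands for the edge <e, e + 1>; the
   values of [x] outside {1, ..., n} are irrelevant. *)
Definition finite_configuration (n : nat) (x : nat -> 'rV[R]_k)
    (es : seq nat) : Prop :=
  [/\ (1 <= n)%N,
      (forall v, (1 <= v <= n)%N -> supp nu (x v))
    & (forall e, e \in es -> (1 <= e < n)%N)].

Definition Dset (theta : R) : set 'rV[R]_k :=
  [set x | forall r, 0 < r -> exists n (x0 : nat -> 'rV[R]_k) (es : seq nat),
     finite_configuration n x0 es /\
     forall v, (1 <= v <= n)%N ->
       cball2 x r (foldl (edge_update mu theta) x0 es v)].

End FiniteConfigurations.

Section Probability.
Context {R : realType} {d : measure_display} {Omega : measurableType d}.
Variable P : probability Omega R.

Definition mutually_independent (I : choiceType) (F : I -> set (set Omega)) :=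
  forall (J : {fset I}) (A : I -> set Omega),
    (forall i, i \in J -> F i (A i)) ->
    P (\bigcap_(i in [set` J]) A i) = (\big[*%E/1%E]_(i <- J) P (A i))%E.

(* The sigma-algebra generated by a process in continuous time [0, +oo[. *)
Definition sigma_process (N : R -> Omega -> nat) : set (set Omega) :=
  <<s \bigcup_(t in [set t : R | 0 <= t]) g_sigma_algebra_preimage (N t) >>.

Record unit_poisson_process (N : R -> Omega -> nat) : Prop := {
  poisson_measurable : forall t, 0 <= t -> measurable_fun setT (N t);
  poisson_start : forall w, N 0 w = 0%N;
  poisson_nondecreasing :
    forall w s t, 0 <= s -> s <= t -> (N s w <= N t w)%N;
  poisson_right_continuous :
    forall w t, 0 <= t -> \forall s \near t^'+, N s w = N t w;
  poisson_increment : forall s t n, 0 <= s -> s < t ->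
    P [set w | (N t w - N s w)%N = n] = (poisson_pmf (t - s) n)%:E;
  poisson_independent_increments : forall t : nat -> R,
    0 <= t 0%N -> (forall i, t i <= t i.+1) ->
    mutually_independent (fun i : nat =>
      g_sigma_algebra_preimage (fun w => N (t i.+1) w - N (t i) w)%N)
}.

End Probability.

Section Deffuant.
Context {R : realType} {k : nat}.
Variables (mu theta : R).

(* The points of a counting path on [0, +oo[ are its jump times. *)
Definition event_at (n : R -> nat) (t : R) : Prop :=
  0 < t /\ forall s, 0 <= s -> s < t -> (n s < n t)%N.

(* [N e] counts the events on the edge <e, e + 1>; [x t v] is the opinion of
   [v] at time [t].  Almost surely no two events are simultaneous and every
   vertex has, on either side, an edge without event up to time [t], so that
   the following rules determine [x] from [x 0] and [N] almost surely. *)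
Record deffuant_path (N : int -> R -> nat) (x : R -> int -> 'rV[R]_k) : Prop := {
  path_constant : forall (v : int) s t, 0 <= s -> s <= t ->
    (forall r, s < r -> r <= t ->
      ~ event_at (N (v - 1)) r /\ ~ event_at (N v) r) ->
    x t v = x s v;
  path_update : forall (u : int) t, event_at (N u) t ->
    exists a b : 'rV[R]_k,
      [/\ x s u @[s --> t^'-] --> a,
          x s (u + 1) @[s --> t^'-] --> b,
          x t u = interact mu theta a b
        & x t (u + 1) = interact mu theta b a]
}.

Context {d : measure_display} {Omega : measurableType d}.

Record deffuant_model (P : probability Omega R)
    (nu : probability (borel_rV R k) R)
    (N : int -> R -> Omega -> nat)
    (eta : R -> int -> Omega -> borel_rV R k) : Prop := {
  deffuant_measurable :
    forall t v, 0 <= t -> measurable_fun setT (eta t v);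
  deffuant_initial_law :
    forall v B, measurable B -> pushforward P (eta 0 v) B = nu B;
  deffuant_poisson : forall e, unit_poisson_process P (N e);
  (* Joint independence of all the initial opinions and all the clocks. *)
  deffuant_independent : mutually_independent P (fun i : int + int =>
    match i with
    | inl v => g_sigma_algebra_preimage (eta 0 v)
    | inr e => sigma_process (N e)
    end);
  deffuant_dynamics : {ae P, forall w,
    deffuant_path (fun e t => N e t w) (fun t v => eta t v w)}
}.

End Deffuant.

(* Main.v *)
(* The set D = D_theta contains supp(nu) and is closed.  If a, b in D are at
   distance at most theta, concatenate many copies of configurations near a and
   near b, in proportions close to 1 - mu and mu: all differences are at most
   theta + eps, so averaging sweeps bring the whole path close to
   (1 - mu) a + mu b, which thus lies in D_(theta + eps) = D.  Almost surely
   every vertex sits between two edges idle up to time t, so eta_t(v) arises by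
   finitely many meetings from values in supp(nu), whence eta_t(v) is in D.
   Conversely, a configuration for theta - eps, stripped of its meetings without
   effect, tolerates small perturbations of the initial values when run at level
   theta; with positive probability the initial opinions are close to it and the
   clocks ring exactly in its order before time t. *)
Require Import Defs.
From mathcomp Require Import finmap.
From mathcomp Require Import all_boot all_order all_algebra.
From mathcomp Require Import all_classical all_reals all_analysis.
From mathcomp Require Import ring lra zify.
Import Order.TTheory GRing.Theory Num.Theory.
Import numFieldTopology.Exports numFieldNormedType.Exports.
Local Open Scope classical_set_scope.
Local Open Scope ring_scope.
Set Implicit Arguments.
Unset Strict Implicit.

(** * The Euclidean norm *)

Section Norm2.
Context {R : realType} {k : nat}.
Implicit Types (x y z a b c : 'rV[R]_k) (r s mu theta : R).

Lemma norm2_ge0 x : 0 <= norm2 x.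
Proof. exact: sqrtr_ge0. Qed.

Lemma sqr_norm2 x : norm2 x ^+ 2 = \sum_(i < k) x ord0 i ^+ 2.
Proof. by rewrite sqr_sqrtr // sumr_ge0 // => i _; rewrite sqr_ge0. Qed.

Lemma norm2Z r x : norm2 (r *: x) = `|r| * norm2 x.
Proof.
rewrite -sqrtr_sqr -sqrtrM ?sqr_ge0 // mulr_sumr /norm2.
by congr Num.sqrt; apply: eq_bigr => i _; rewrite mxE exprMn.
Qed.

Lemma norm2N x : norm2 (- x) = norm2 x.
Proof. by rewrite -scaleN1r norm2Z normrN normr1 mul1r. Qed.

Lemma norm2B x y : norm2 (x - y) = norm2 (y - x).
Proof. by rewrite -norm2N opprB. Qed.

Lemma norm20 : norm2 (0 : 'rV[R]_k) = 0.
Proof. by rewrite -(scale0r 0) norm2Z normr0 mul0r. Qed.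

Lemma sqr_norm2D x y :
  norm2 (x + y) ^+ 2 =
  norm2 x ^+ 2 + norm2 y ^+ 2 + (\sum_(i < k) x ord0 i * y ord0 i) *+ 2.
Proof.
rewrite !sqr_norm2 -mulr_natl mulr_sumr -!big_split /=.
by apply: eq_bigr => i _; rewrite mxE; ring.
Qed.

(** Cauchy-Schwarz: expanding the squared norm of [norm2 y *: x - norm2 x *: y] gives
    [(p * q) * (p * q - d) >= 0]. If [p * q = 0], one of the vectors vanishes. *)
Lemma norm2_dot_le x y :
  \sum_(i < k) x ord0 i * y ord0 i <= norm2 x * norm2 y.
Proof.
have dotZ a b : \sum_(i < k) (norm2 b *: a) ord0 i * (- norm2 a *: b) ord0 i
    = - (norm2 a * norm2 b) * \sum_(i < k) a ord0 i * b ord0 i.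
  by rewrite mulr_sumr; apply: eq_bigr => i _; rewrite !mxE; ring.
have := sqr_ge0 (norm2 (norm2 y *: x + (- norm2 x) *: y)).
rewrite sqr_norm2D dotZ !norm2Z normrN !ger0_norm ?norm2_ge0 //.
set d := \sum_(i < k) _; set p := norm2 x; set q := norm2 y => h.
have := norm2_ge0 x; have := norm2_ge0 y; rewrite -/p -/q => q0 p0.
have [pq0|pq0] := ltP 0 (p * q).
  suff : 0 <= (p * q) * (p * q - d) by rewrite pmulr_rge0 // subr_ge0.
  by move: h; rewrite -mulr_natl; nra.
have : p * q == 0 by rewrite eq_le pq0 mulr_ge0.
have zero a : norm2 a = 0 -> forall i, a ord0 i = 0.
  move=> a0 i; have := sqr_norm2 a; rewrite a0 expr0n /= => /esym /eqP.
  rewrite psumr_eq0 => [/allP/(_ i)|j _]; last exact: sqr_ge0.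
  by rewrite mem_index_enum sqrf_eq0 => /(_ isT)/eqP.
rewrite /d mulf_eq0 => /orP[] /eqP /zero z0.
  by rewrite big1 ?mulr_ge0 // => i _; rewrite z0 mul0r.
by rewrite big1 ?mulr_ge0 // => i _; rewrite z0 mulr0.
Qed.

Lemma ler_norm2D x y : norm2 (x + y) <= norm2 x + norm2 y.
Proof.
rewrite -(@ler_pXn2r _ 2) ?nnegrE ?addr_ge0 ?norm2_ge0 //.
rewrite sqr_norm2D sqrrD.
have := norm2_dot_le x y; rewrite !mulr2n; lra.
Qed.

Lemma ler_norm2_dist z x y : norm2 (x - y) <= norm2 (x - z) + norm2 (z - y).
Proof. by apply: le_trans (ler_norm2D _ _); rewrite addrA subrK. Qed.

Lemma norm2_mix_le mu a b c r : 0 <= mu -> mu <= 1 ->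
  norm2 (a - c) <= r -> norm2 (b - c) <= r ->
  norm2 (a + mu *: (b - a) - c) <= r.
Proof.
move=> mu0 mu1 ac bc.
have -> : a + mu *: (b - a) - c = (1 - mu) *: (a - c) + mu *: (b - c).
  by apply/rowP => i; rewrite !mxE; ring.
apply: le_trans (ler_norm2D _ _) _.
rewrite !norm2Z !ger0_norm ?subr_ge0 //.
have := ler_wpM2l mu0 bc; have : 0 <= 1 - mu by rewrite subr_ge0.
by move=> /ler_wpM2l /(_ _ _ ac); lra.
Qed.

(** A meeting dissipates a fixed multiple of the squared gap; this loss of energy is what makes
    [averaging] terminate. *)
Lemma sqr_norm2_mix mu a b :
  norm2 (a + mu *: (b - a)) ^+ 2 + norm2 (b + mu *: (a - b)) ^+ 2 =
  norm2 a ^+ 2 + norm2 b ^+ 2 - 2 * mu * (1 - mu) * norm2 (a - b) ^+ 2.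
Proof.
rewrite !sqr_norm2 mulr_sumr -!big_split -sumrB /=.
by apply: eq_bigr => i _; rewrite !mxE; ring.
Qed.

Lemma norm2_continuous : continuous (@norm2 R k).
Proof.
move=> x; apply: (@continuous_comp _ _ _
  (fun x : 'rV[R]_k => \sum_(i < k) x ord0 i ^+ 2) Num.sqrt); last first.
  exact: sqrt_continuous.
have coord2 (i : 'I_k) : continuous (fun x : 'rV[R]_k => x ord0 i ^+ 2).
  move=> y; apply: (@continuous_comp _ _ _ (fun x : 'rV[R]_k => x ord0 i)
    (fun z : R => z ^+ 2)); [exact: coord_continuous|exact: exprn_continuous].
apply: (cvg_big _ (nbhs_filter x)) => [|i _]; first exact: add_continuous.
exact: coord2.
Qed.

Lemma norm2_dist_continuous y : continuous (fun x => norm2 (x - y)).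
Proof.
move=> x; apply: (@continuous_comp _ _ _ (fun x => x - y) (@norm2 R k)).
  by apply: continuousB; [exact: cvg_id|exact: cst_continuous].
exact: norm2_continuous.
Qed.

Lemma closed_cball2 y r : closed (cball2 y r).
Proof.
rewrite (_ : cball2 y r = (fun x => norm2 (x - y)) @^-1` [set z | z <= r]) //.
apply: closed_comp; last exact: closed_le.
by move=> x _; exact: norm2_dist_continuous.
Qed.

Lemma norm2_le_coord x r : 0 <= r -> (forall i, `|x ord0 i| <= r) ->
  norm2 x <= k%:R * r.
Proof.
move=> r0 xr; have kr0 : 0 <= k%:R * r by rewrite mulr_ge0.
rewrite -(@ler_pXn2r _ 2) ?nnegrE ?norm2_ge0 // sqr_norm2.
apply: (@le_trans _ _ (\sum_(i < k) r ^+ 2)).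
  apply: ler_sum => i _; rewrite -real_normK ?num_real //.
  by rewrite ler_pXn2r ?nnegrE ?normr_ge0.
rewrite sumr_const card_ord -[leLHS]mulr_natl exprMn ler_wpM2r ?sqr_ge0 //.
by rewrite -natrX ler_nat; case: (k) => // m; rewrite -mulnn leq_pmulr.
Qed.

End Norm2.

(** * Finite configurations *)

Section Updates.
Context {R : realType} {k : nat}.
Variables (mu theta : R).
Implicit Types (a b c : 'rV[R]_k) (xi zeta : nat -> 'rV[R]_k).
Implicit Types (n m e v w : nat) (es : seq nat).
Local Notation upd := (edge_update mu theta).
Local Notation meet := (interact mu theta).

Lemma edge_update_left xi e : upd xi e e = meet (xi e) (xi e.+1).
Proof. by rewrite /edge_update eqxx. Qed.

Lemma edge_update_right xi e : upd xi e e.+1 = meet (xi e.+1) (xi e).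
Proof. by rewrite /edge_update gtn_eqF // eqxx. Qed.

Lemma edge_update_other xi e v :
  v != e -> v != e.+1 -> upd xi e v = xi v.
Proof. by rewrite /edge_update => /negbTE -> /negbTE ->. Qed.

(** The vertex is an index, so that [case: edge_updateP] also replaces it by [e] or [e.+1] in the
    rest of the goal. *)
Variant edge_update_spec xi e : nat -> 'rV[R]_k -> Prop :=
| EdgeUpdateLeft : edge_update_spec xi e e (meet (xi e) (xi e.+1))
| EdgeUpdateRight : edge_update_spec xi e e.+1 (meet (xi e.+1) (xi e))
| EdgeUpdateOther v of v != e & v != e.+1 : edge_update_spec xi e v (xi v).

Lemma edge_updateP xi e v : edge_update_spec xi e v (upd xi e v).
Proof.
have [->|ve] := eqVneq v e; first by rewrite edge_update_left; constructor.
have [->|ve1] := eqVneq v e.+1; first by rewrite edge_update_right; constructor.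
by rewrite edge_update_other //; constructor.
Qed.

Lemma edge_update_ind (C : 'rV[R]_k -> Prop) n xi e :
  (forall a b, C a -> C b -> C (meet a b)) -> (1 <= e < n)%N ->
  (forall v, (1 <= v <= n)%N -> C (xi v)) ->
  forall v, (1 <= v <= n)%N -> C (upd xi e v).
Proof.
move=> CC en Cxi v; have Ce : C (xi e) by apply: Cxi; lia.
have Ce1 : C (xi e.+1) by apply: Cxi; lia.
by case: edge_updateP => [_|_|w _ _ wn]; [exact: CC|exact: CC|exact: Cxi].
Qed.

(** An update reads and writes only its two endpoints, so a translated schedule sees only its own
    block. Schedules of disjoint blocks can thus be run one after the other. *)
Lemma foldl_edge_update_shift m n es xi zeta :
  (forall e, e \in es -> (1 <= e < n)%N) ->
  (forall v, (1 <= v <= n)%N -> zeta (m + v)%N = xi v) ->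
  (forall v, (1 <= v <= n)%N ->
     foldl upd zeta (map (addn m) es) (m + v)%N = foldl upd xi es v) /\
  (forall w, ~~ (m < w <= m + n)%N ->
     foldl upd zeta (map (addn m) es) w = zeta w).
Proof.
elim: es xi zeta => [|e es IH] xi zeta esn agree //=.
have en : (1 <= e < n)%N by apply: esn; rewrite mem_head.
have ae : zeta (m + e)%N = xi e by apply: agree; lia.
have ae1 : zeta (m + e).+1 = xi e.+1 by rewrite -addnS; apply: agree; lia.
have [|v vn|IH1 IH2] := IH (upd xi e) (upd zeta (m + e)).
- by move=> e' e's; apply: esn; rewrite inE e's orbT.
- case: (edge_updateP xi e v) vn => [_|_|w we we1 wn].
  + by rewrite edge_update_left ae ae1.
  + by rewrite addnS edge_update_right ae ae1.
  + by rewrite edge_update_other ?agree //; lia.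
split=> // w wn; rewrite IH2 // edge_update_other //; lia.
Qed.

(** Only two terms change, and [rest] collects the others. The codomain is arbitrary so as to serve
    both the energy and the conserved total in [averaging]. *)
Lemma sum_edge_update (V : nmodType) (f : 'rV[R]_k -> V) n xi e :
  (1 <= e < n)%N -> exists rest : V,
  \sum_(1 <= v < n.+1) f (upd xi e v) =
    f (meet (xi e) (xi e.+1)) + (f (meet (xi e.+1) (xi e)) + rest) /\
  \sum_(1 <= v < n.+1) f (xi v) = f (xi e) + (f (xi e.+1) + rest).
Proof.
move=> en.
have split (g : nat -> V) : \sum_(1 <= v < n.+1) g v =
    g e + (g e.+1 + (\sum_(1 <= v < e) g v + \sum_(e.+2 <= v < n.+1) g v)).
  rewrite (@big_cat_nat _ _ _ e) /=; [|lia|lia].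
  rewrite (@big_ltn _ _ _ e) /=; last lia.
  rewrite (@big_ltn _ _ _ e.+1) /=; last lia.
  by rewrite addrCA; congr (_ + _); rewrite addrCA.
exists (\sum_(1 <= v < e) f (xi v) + \sum_(e.+2 <= v < n.+1) f (xi v)).
rewrite !split edge_update_left edge_update_right; split=> //.
congr (_ + (_ + (_ + _))); apply: eq_big_nat => v ve.
  by rewrite edge_update_other //; lia.
by rewrite edge_update_other //; lia.
Qed.

Lemma interact_near a b : norm2 (a - b) <= theta -> meet a b = a + mu *: (b - a).
Proof. by rewrite /interact => ->. Qed.

Lemma interact_in_cball c r a b : 0 <= mu -> mu <= 1 ->
  cball2 c r a -> cball2 c r b -> cball2 c r (meet a b).
Proof.
rewrite /interact /cball2 /= => mu0 mu1 ac bc.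
by case: ifP => _ //; exact: norm2_mix_le.
Qed.

End Updates.

(** * Reachable opinion profiles and their averaging *)

Section Reachable.
Context {R : realType} {k : nat}.
Variables (mu : R) (nu : set 'rV[R]_k -> \bar R) (theta : R).
Implicit Types (a b c : 'rV[R]_k) (xi zeta : nat -> 'rV[R]_k).
Implicit Types (n m e v w : nat) (es : seq nat) (A B : set 'rV[R]_k).
Local Notation upd := (edge_update mu theta).

(* Contrary to [finite_configuration], the empty path [n = 0] is allowed. *)
Definition reachable n xi : Prop := exists x0 es,
  [/\ forall v, (1 <= v <= n)%N -> supp nu (x0 v),
      forall e, e \in es -> (1 <= e < n)%N
    & forall v, (1 <= v <= n)%N -> foldl upd x0 es v = xi v].

Definition reachable_in n A : Prop :=
  exists2 xi, reachable n xi & forall v, (1 <= v <= n)%N -> A (xi v).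

Lemma DsetP x : Dset mu nu theta x <->
  forall r, 0 < r -> exists2 n, (1 <= n)%N & reachable_in n (cball2 x r).
Proof.
split=> Dx r /Dx.
  case=> n [x0 [es [[n1 x0s esn] xr]]]; exists n => //.
  by exists (foldl upd x0 es) => //; exists x0, es; split.
case=> n n1 [xi [x0 [es [x0s esn xiE]]] xir]; exists n, x0, es.
by split=> // v vn; rewrite xiE //; exact: xir.
Qed.

Lemma reachable_update n xi e :
  (1 <= e < n)%N -> reachable n xi -> reachable n (upd xi e).
Proof.
move=> en [x0 [es [x0s esn xiE]]]; exists x0, (rcons es e); split=> //.
  by move=> e'; rewrite mem_rcons inE => /predU1P[->|/esn].
move=> v vn; rewrite foldl_rcons.
have e1 : foldl upd x0 es e = xi e by apply: xiE; lia.
have e2 : foldl upd x0 es e.+1 = xi e.+1 by apply: xiE; lia.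
case: edge_updateP vn => [_|_|w we we1 wn].
- by rewrite edge_update_left e1 e2.
- by rewrite edge_update_right e1 e2.
- by rewrite edge_update_other ?xiE.
Qed.

Lemma reachable_cat n m xi zeta : reachable n xi -> reachable m zeta ->
  reachable (n + m) (fun v => if (v <= n)%N then xi v else zeta (v - n)%N).
Proof.
move=> [xa [esa [xas esan xaE]]] [xb [esb [xbs esbm xbE]]].
pose x0 v := if (v <= n)%N then xa v else xb (v - n)%N.
exists x0, (esa ++ map (addn n) esb); split.
- move=> v vn; rewrite /x0; case: ifP => vn'; first by apply: xas; lia.
  by apply: xbs; lia.
- move=> e; rewrite mem_cat => /orP[/esan|/mapP[e' /esbm e'm ->]]; lia.
move=> v vn; rewrite foldl_cat.
have [] := @foldl_edge_update_shift R k mu theta 0 n esa xa x0 esan.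
  by move=> w wn; rewrite add0n /x0 ifT //; lia.
rewrite (eq_map add0n) map_id => z1 z2.
have [] := @foldl_edge_update_shift R k mu theta n m esb xb (foldl upd x0 esa) esbm.
  move=> w wm; rewrite z2 ?add0n; last lia.
  by rewrite /x0 ifF; [congr xb|]; lia.
move=> z3 z4; case: ifP => vn'.
  have := z1 v; rewrite add0n => z1v.
  by rewrite z4 ?z1v ?xaE //; lia.
by rewrite -{1}(@subnKC n v) ?z3 ?xbE //; lia.
Qed.

Lemma reachable_blocks n m A B : reachable_in n A -> reachable_in m B ->
  exists xi, [/\ reachable (n + m) xi,
    forall v, (1 <= v <= n)%N -> A (xi v)
  & forall v, (n < v <= n + m)%N -> B (xi v)].
Proof.
move=> [xi rxi Axi] [zeta rzeta Bzeta].
exists (fun v => if (v <= n)%N then xi v else zeta (v - n)%N); split.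
- exact: reachable_cat.
- by move=> v vn; rewrite ifT; [exact: Axi|lia].
- by move=> v vn; rewrite ifF; [apply: Bzeta|]; lia.
Qed.

Lemma reachable_in_mul p n A : reachable_in n A -> reachable_in (p * n) A.
Proof.
move=> An; elim: p => [|p [zeta rzeta Azeta]].
  (* Zero copies form the empty path; this is where [n = 0] matters. *)
  have [xi _ _] := An; exists xi; last by move=> v; lia.
  by exists xi, [::]; split=> // v; lia.
have /(_ _)[|xi [rxi Axi Bxi]] := @reachable_blocks n (p * n) A A An.
  by exists zeta.
rewrite mulSn; exists xi => // v vn.
by have [?|?] := leqP v n; [apply: Axi|apply: Bxi]; lia.
Qed.

Definition diam_le n xi r : Prop := forall v w,
  (1 <= v <= n)%N -> (1 <= w <= n)%N -> norm2 (xi v - xi w) <= r.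

Hypotheses (mu_gt0 : 0 < mu) (mu_lt1 : mu < 1).

(** Balls are convex, hence stable under meetings. This is used around the updated value at [v] to
    return [w] to its old value, then around that old value for [v]. *)
Lemma diam_le_update n xi e r : (1 <= e < n)%N ->
  diam_le n xi r -> diam_le n (upd xi e) r.
Proof.
move=> en dxi v w vn wn; rewrite norm2B.
apply: (@edge_update_ind _ _ mu theta (cball2 (upd xi e v) r) n) => //.
  by move=> a b; apply: interact_in_cball; exact: ltW.
move=> w' wn'; rewrite /cball2 /= norm2B.
apply: (@edge_update_ind _ _ mu theta (cball2 (xi w') r) n) => //.
  by move=> a b; apply: interact_in_cball; exact: ltW.
by move=> v' vn'; exact: dxi.
Qed.

Lemma diam_le_adjacent n xi r : 0 <= r ->
  (forall e, (1 <= e < n)%N -> norm2 (xi e - xi e.+1) <= r) ->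
  diam_le n xi (n%:R * r).
Proof.
move=> r0 adj.
have chain v j : (1 <= v)%N -> (v + j <= n)%N ->
    norm2 (xi v - xi (v + j)%N) <= j%:R * r.
  elim: j => [|j IH] v1 vj; first by rewrite addn0 subrr norm20 mul0r.
  apply: le_trans (@ler_norm2_dist _ _ (xi (v + j)%N) _ _) _.
  rewrite -natr1 mulrDl mul1r lerD ?IH ?addnS //; first by lia.
  by apply: adj; lia.
have far v w : (1 <= v)%N -> (v <= w)%N -> (w <= n)%N ->
    norm2 (xi v - xi w) <= n%:R * r.
  move=> v1 vw wn; rewrite -(subnKC vw).
  apply: le_trans (chain _ _ v1 _) _; first by lia.
  by rewrite ler_wpM2r // ler_nat; lia.
move=> v w vn wn; have [vw|wv] := leqP v w; first by apply: far; lia.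
by rewrite norm2B; apply: far; lia.
Qed.

(* Every update across a gap larger than [r] decreases the sum of the squared
   norms by more than [2 * mu * (1 - mu) * r ^+ 2]. *)
Lemma averaging n xi r : 0 < r -> reachable n xi -> diam_le n xi theta ->
  exists zeta, [/\ reachable n zeta, diam_le n zeta (n%:R * r)
    & \sum_(1 <= v < n.+1) zeta v = \sum_(1 <= v < n.+1) xi v].
Proof.
move=> r0.
have mu1 : 0 < 1 - mu by rewrite subr_gt0.
pose c := 2 * mu * (1 - mu) * r ^+ 2.
have c0 : 0 < c by rewrite /c !mulr_gt0 ?exprn_gt0.
pose E (z : nat -> 'rV[R]_k) := \sum_(1 <= v < n.+1) norm2 (z v) ^+ 2.
have E0 z : 0 <= E z by apply: sumr_ge0 => v _; rewrite sqr_ge0.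
(* [M] bounds the number of remaining updates: each costs at least [c] of the nonnegative energy
   [E]. *)
have [M] : exists M : nat, E xi <= M%:R * c.
  exists (Num.bound (E xi / c)); rewrite -ler_pdivrMr //.
  by apply: ltW; apply: archi_boundP; rewrite divr_ge0 // ltW.
elim: M xi => [|M IH] xi Exi rxi dxi.
all: have [[e en gap]|nogap] :=
  pselect (exists2 e, (1 <= e < n)%N & r < norm2 (xi e - xi e.+1)).
2,4: exists xi; split=> //; apply: diam_le_adjacent => [|e en];
  [exact: ltW|by rewrite leNgt; apply/negP => gap; apply: nogap; exists e].
(* The diameter is at most [theta], so the chosen meeting takes effect. *)
all: have de : norm2 (xi e - xi e.+1) <= theta by apply: dxi; lia.
all: have de' : norm2 (xi e.+1 - xi e) <= theta by rewrite norm2B.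
all: have drop : E (upd xi e) <= E xi - c.
1,3: have [rest []] :=
    @sum_edge_update _ _ mu theta R (fun a => norm2 a ^+ 2) n xi e en;
  rewrite /E => -> ->; rewrite !interact_near //;
  have := sqr_norm2_mix mu (xi e) (xi e.+1);
  have : c <= 2 * mu * (1 - mu) * norm2 (xi e - xi e.+1) ^+ 2;
  [by rewrite ler_pM2l ?mulr_gt0 // ler_pXn2r ?nnegrE ?norm2_ge0 ?ltW|lra].
  by exfalso; have := E0 (upd xi e); rewrite mul0r in Exi; lra.
have [|||zeta [rz dz sz]] := IH (upd xi e).
- by move: Exi; rewrite -natr1 mulrDl mul1r; lra.
- exact: reachable_update.
- exact: diam_le_update.
exists zeta; split=> //; rewrite sz.
have [rest [-> ->]] := @sum_edge_update _ _ mu theta _ id n xi e en.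
rewrite !interact_near // !addrA; congr (_ + _).
by apply/rowP => i; rewrite !mxE; ring.
Qed.

End Reachable.

(** * Closedness of [Dset], mixtures and perturbations *)

Section DsetClosure.
Context {R : realType} {k : nat}.
Variables (mu : R) (nu : set 'rV[R]_k -> \bar R) (theta : R).
Implicit Types (a b c x y : 'rV[R]_k) (r : R).

Lemma ler_norm2_sum (I : Type) (s : seq I) (P : pred I) (F : I -> 'rV[R]_k) :
  norm2 (\sum_(i <- s | P i) F i) <= \sum_(i <- s | P i) norm2 (F i).
Proof.
elim/big_ind2 : _ => [|x1 y1 x2 y2 h1 h2|//]; first by rewrite norm20.
by apply: le_trans (ler_norm2D _ _) _; exact: lerD.
Qed.

Lemma supp_sub_Dset : supp nu `<=` Dset mu nu theta.
Proof.
move=> x sx r r0; exists 1%N, (fun=> x), [::]; split; first by split.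
by move=> v _; rewrite /cball2 /= subrr norm20 ltW.
Qed.

Lemma Dset_approx x :
  (forall r, 0 < r -> exists2 y, Dset mu nu theta y & norm2 (y - x) <= r) ->
  Dset mu nu theta x.
Proof.
move=> hx r r0; have r2 : 0 < r / 2 by rewrite divr_gt0.
have [y /(_ _ r2)[n [x0 [es [cf yr]]]] yx] := hx _ r2.
exists n, x0, es; split=> // v vn; rewrite /cball2 /=.
apply: le_trans (ler_norm2_dist y _ _) _.
by rewrite (splitr r) lerD // ; exact: yr.
Qed.

(** Closedness along a filter is the form needed for the dynamics: [path_update] gives the opinions
    before a meeting only as left limits. *)
Lemma Dset_lim (F : set_system R) (FF : ProperFilter F) (g : R -> 'rV[R]_k) a :
  (\forall q \near F, Dset mu nu theta (g q)) -> g q @[q --> F] --> a ->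
  Dset mu nu theta a.
Proof.
move=> Dg ga; apply: Dset_approx => r r0.
have gd : norm2 (g q - a) @[q --> F] --> (0 : R).
  rewrite -(@norm20 R k) -(subrr a).
  exact: (cvg_comp _ _ ga (@norm2_dist_continuous R k a a)).
have /filter_ex[q [Dq qr]] :
    \forall q \near F, Dset mu nu theta (g q) /\ norm2 (g q - a) < r.
  by apply: filterI => //; exact: (cvgr_lt 0).
by exists (g q) => //; exact: ltW.
Qed.

Lemma diam_le_blocks (n1 n : nat) (xi : nat -> 'rV[R]_k) a b r :
  norm2 (a - b) <= theta ->
  (forall v, (1 <= v <= n1)%N -> norm2 (xi v - a) <= r) ->
  (forall v, (n1 < v <= n)%N -> norm2 (xi v - b) <= r) ->
  diam_le n xi (theta + (r + r)).
Proof.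
move=> ab xia xib.
have dd (c c' u w : 'rV[R]_k) : norm2 (c - c') <= theta ->
    norm2 (u - c) <= r -> norm2 (w - c') <= r -> norm2 (u - w) <= theta + (r + r).
  move=> cc' uc wc'; have := ler_norm2_dist c u w.
  have := ler_norm2_dist c' c w; rewrite (norm2B c' w); lra.
have ba : norm2 (b - a) <= theta by rewrite norm2B.
have cc c : norm2 (c - c) <= theta.
  by rewrite subrr norm20; exact: le_trans (norm2_ge0 _) ab.
move=> v w vn wn; have [v1|v1] := leqP v n1; have [w1|w1] := leqP w n1.
- by apply: (dd _ _ _ _ (cc a) (xia _ _) (xia _ _)); lia.
- by apply: (dd _ _ _ _ ab (xia _ _) (xib _ _)); lia.
- by apply: (dd _ _ _ _ ba (xib _ _) (xia _ _)); lia.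
- by apply: (dd _ _ _ _ (cc b) (xib _ _) (xib _ _)); lia.
Qed.

(** Take for [q] the integer part of [m * K], which is at most [K]. *)
Lemma mixture_counts (m : R) K : 0 <= m -> m <= 1 ->
  exists p q : nat, (p + q = K)%N /\ `|q%:R - m * K%:R| <= 1.
Proof.
move=> m0 m1; have mK : 0 <= m * K%:R by rewrite mulr_ge0.
have [qle qlt] := andP (truncn_itv mK).
have qK : (Num.truncn (m * K%:R) <= K)%N.
  by rewrite -(ler_nat R) (le_trans qle) // ler_piMl.
exists (K - Num.truncn (m * K%:R))%N, (Num.truncn (m * K%:R)).
split; first by rewrite subnK.
by rewrite distrC ger0_norm ?subr_ge0 // lerBlDr addrC natr1 ltW.
Qed.

(* Blocks of copies of configurations near [a] and near [b], in proportions
   close to [1 - mu] and [mu], average out to nearly [a + mu *: (b - a)]. *)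
Lemma Dset_mix eps a b : 0 < mu -> mu < 1 -> 0 < eps -> 0 <= theta ->
  Dset mu nu (theta + eps) a -> Dset mu nu (theta + eps) b ->
  norm2 (a - b) <= theta -> Dset mu nu (theta + eps) (a + mu *: (b - a)).
Proof.
move=> mu0 mu1 eps0 theta0 /DsetP Da /DsetP Db ab; apply/DsetP => rho rho0.
(* [rho / 3] is the share of one of the three errors below; [eps / 2] keeps the diameter of the
   joined blocks within [theta + eps]. *)
pose r := Num.min (rho / 3) (eps / 2).
have r0 : 0 < r by rewrite lt_min !divr_gt0.
have r_rho : r <= rho / 3 by rewrite ge_min lexx.
have r_eps : r <= eps / 2 by rewrite ge_min lexx orbT.
have [na na1 Ra] := Da _ r0; have [nb nb1 Rb] := Db _ r0.
(* Rounding the proportions to multiples of [1 / K] will cost at most [theta / K]. *)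
have [K K0 thetaK] : exists2 K : nat, (0 < K)%N & theta <= K%:R * (rho / 3).
  exists (Num.bound (theta / (rho / 3))).+1 => //.
  rewrite -ler_pdivrMr ?divr_gt0 //; apply: ltW.
  apply: lt_le_trans (archi_boundP _) _; first by rewrite !divr_ge0 // ltW.
  by rewrite ler_nat.
have [p [q [pqK qmu]]] := @mixture_counts mu K (ltW mu0) (ltW mu1).
(* Scaling the number of copies by the length of the other configuration makes the block sizes
   exactly proportional to [p] and [q], even if [na] and [nb] differ. *)
have [xi [rxi xia xib]] := reachable_blocks
  (reachable_in_mul (p * nb) Ra)
  (reachable_in_mul (q * na) Rb).
have nE : (p * nb * na + q * na * nb)%N = (K * (na * nb))%N.
  by rewrite -pqK mulnDl -!mulnA [(nb * na)%N]mulnC.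
have n2E : (q * na * nb)%:R - mu * (K * (na * nb))%:R =
    (na * nb)%:R * (q%:R - mu * K%:R) by rewrite !natrM; ring.
have n_gt0 : (0 < K * (na * nb))%N by rewrite !muln_gt0 K0 na1.
move: rxi xia xib nE n2E n_gt0.
set n1 := (p * nb * na)%N; set n2 := (q * na * nb)%N.
set n := (K * (na * nb))%N => rxi xia xib nE n2E n_gt0.
have nR : n%:R = K%:R * (na * nb)%:R :> R by rewrite /n natrM.
rewrite nE in rxi xib.
clearbody n1 n2 n.
have nR0 : 0 < n%:R :> R by rewrite ltr0n.
have {}xia v : (1 <= v <= n1)%N -> norm2 (xi v - a) <= r by exact: xia.
have {}xib v : (n1 < v <= n)%N -> norm2 (xi v - b) <= r by exact: xib.
have dxi : diam_le n xi (theta + eps).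
  move=> v w vn wn; apply: le_trans (diam_le_blocks ab xia xib vn wn) _.
  by rewrite lerD2l (splitr eps) lerD.
have delta0 : 0 < rho / 3 / n%:R by rewrite !divr_gt0.
have [zeta [rz dz sz]] := averaging mu0 mu1 delta0 rxi dxi.
exists n => //; exists zeta => // v vn; rewrite /cball2 /=.
set c := a + mu *: (b - a).
(* Three errors: the spread of [zeta], whose total is that of [xi]; the distances of the blocks from
   [a] and [b]; the rounding of the proportions. *)
have key : n%:R *: (zeta v - c) = \sum_(1 <= w < n.+1) (zeta v - zeta w) +
    (\sum_(1 <= w < n1.+1) (xi w - a) + \sum_(n1.+1 <= w < n.+1) (xi w - b) +
     (n2%:R - mu * n%:R) *: (b - a)).
  have sumB s t u (g : nat -> 'rV[R]_k) : \sum_(s <= w < t) (g w - u) =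
      \sum_(s <= w < t) g w - (t - s)%:R *: u.
    by rewrite sumrB big_const_nat iter_addr_0 scaler_nat.
  rewrite sumrB big_const_nat iter_addr_0 subn1 /= sz -[zeta v *+ n]scaler_nat !sumB.
  rewrite (@big_cat_nat _ _ _ n1.+1 1 n.+1) //=; last by rewrite ltnS -nE leq_addr.
  rewrite !subSS subn0 (_ : (n - n1 = n2)%N); last by rewrite -nE addKn.
  set s1 := \sum_(_ <= _ < _) _; set s2 := \sum_(_ <= _ < _) _.
  apply/rowP => i; rewrite /c -nE natrD !mxE; ring.
have : norm2 (n%:R *: (zeta v - c)) <= n%:R * rho.
  rewrite key; apply: le_trans (ler_norm2D _ _) _.
  rewrite (_ : n%:R * rho = n%:R * (rho / 3) +
    (n1%:R * (rho / 3) + n2%:R * (rho / 3) + n%:R * (rho / 3))); last first.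
    by rewrite -nE natrD; field.
  have sumle s t (g : nat -> 'rV[R]_k) (e : R) :
      (forall w, (s <= w < t)%N -> norm2 (g w) <= e) ->
      norm2 (\sum_(s <= w < t) g w) <= (t - s)%:R * e.
    move=> ge; apply: le_trans (ler_norm2_sum _ _ _) _.
    apply: (@le_trans _ _ (\sum_(s <= w < t) e)).
      by rewrite !big_nat; apply: ler_sum.
    by rewrite big_const_nat iter_addr_0 mulr_natl.
  apply: lerD; first last.
    apply: le_trans (ler_norm2D _ _) _; apply: lerD.
      apply: le_trans (ler_norm2D _ _) _; apply: lerD.
        rewrite -{2}[n1](subn1 n1.+1); apply: sumle => w w1.
        by apply: le_trans r_rho; exact: xia.
      rewrite -[n2](addKn n1) nE -subSS; apply: sumle => w w1.
      by apply: le_trans r_rho; exact: xib.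
    (* The rounding error [n2 - mu * n] is at most [na * nb = n / K] in absolute value. *)
    rewrite norm2Z; apply: (@le_trans _ _ ((na * nb)%:R * theta)).
      apply: ler_pM; rewrite ?norm2_ge0 ?normr_ge0 //; last by rewrite norm2B.
      by rewrite n2E normrM ger0_norm // ler_piMr.
    by rewrite nR (mulrC K%:R) -mulrA ler_wpM2l.
  rewrite -[X in X%:R * _](subn1 n.+1); apply: sumle => w wn.
  by apply: le_trans (dz _ _ vn wn) _; rewrite mulrCA divff ?mulr1 // gt_eqF.
by rewrite norm2Z ger0_norm // ler_pM2l.
Qed.

(* A configuration for [theta - eps] is robust: dropping the meetings without
   effect, the others still take place at level [theta] after a small
   perturbation of the initial values, and the maps applied are contractions. *)
Lemma perturbed_configuration eps delta n (xi : nat -> 'rV[R]_k) (es : seq nat) :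
  0 <= mu -> mu <= 1 -> delta + delta <= eps ->
  (forall e, e \in es -> (1 <= e < n)%N) ->
  exists2 es' : seq nat, forall e, e \in es' -> (1 <= e < n)%N &
  forall zeta : nat -> 'rV[R]_k,
    (forall v, (1 <= v <= n)%N -> norm2 (zeta v - xi v) <= delta) ->
  forall v, (1 <= v <= n)%N ->
    norm2 (foldl (edge_update mu theta) zeta es' v -
           foldl (edge_update mu (theta - eps)) xi es v) <= delta.
Proof.
move=> mu0 mu1 deps; elim: es xi => [|e es IH] xi esn /=; first by exists [::].
have [|es' es'n hes'] := IH (edge_update mu (theta - eps) xi e).
  by move=> e' e's; apply: esn; rewrite inE e's orbT.
have en : (1 <= e < n)%N by apply: esn; rewrite mem_head.
have [near|far] := boolP (norm2 (xi e - xi e.+1) <= theta - eps).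
  exists (e :: es') => [e'|zeta hz /=]; first by rewrite inE => /predU1P[->|/es'n].
  apply: hes' => v vn.
  have he : norm2 (zeta e - xi e) <= delta by apply: hz; lia.
  have he1 : norm2 (zeta e.+1 - xi e.+1) <= delta by apply: hz; lia.
  (* Two perturbations of size [delta] fit into the slack [eps], so the meeting also takes effect on
     [zeta]. *)
  have nearz : norm2 (zeta e - zeta e.+1) <= theta.
    have := ler_norm2_dist (xi e) (zeta e) (zeta e.+1).
    have := ler_norm2_dist (xi e.+1) (xi e) (zeta e.+1).
    by rewrite (norm2B (xi e.+1) (zeta e.+1)); lra.
  (* The difference of two mixtures is the mixture of the differences. *)
  have contract a b c d : norm2 (a - b) <= delta -> norm2 (c - d) <= delta ->
      norm2 (a + mu *: (c - a) - (b + mu *: (d - b))) <= delta.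
    move=> ab cd; have := @norm2_mix_le _ _ mu (a - b) (c - d) 0 delta mu0 mu1.
    rewrite !subr0 => /(_ ab cd); congr (_ <= _); congr norm2.
    by apply/rowP => i; rewrite !mxE; ring.
  have nearz' : norm2 (zeta e.+1 - zeta e) <= theta by rewrite norm2B.
  have near' : norm2 (xi e.+1 - xi e) <= theta - eps by rewrite norm2B.
  case: (edge_updateP mu (theta - eps) xi e v) vn => [_|_|w we we1 wn].
  - by rewrite edge_update_left !interact_near //; exact: contract.
  - by rewrite edge_update_right !interact_near //; exact: contract.
  - by rewrite edge_update_other //; exact: hz.
(* The meeting has no effect on [xi] but might have one on [zeta], so it is dropped. *)
exists es' => // zeta hz; apply: hes' => v vn.
have far' : norm2 (xi e.+1 - xi e) <= theta - eps = false.
  by rewrite norm2B; exact/negbTE.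
by case: (edge_updateP mu (theta - eps) xi e v) vn => [vn|vn|w _ _ vn];
  rewrite /interact ?far' ?(negbTE far); exact: hz.
Qed.

End DsetClosure.

(** * The complement of the support is negligible *)

Section Support.
Context {R : realType} {k : nat}.

Lemma measurable_cball2 (y : 'rV[R]_k) r :
  measurable (cball2 y r : set (borel_rV R k)).
Proof.
rewrite -[cball2 y r]setCK; apply: measurableC.
by apply: sub_sigma_algebra; rewrite openC; exact: closed_cball2.
Qed.

Lemma rat_norm2_dense (y : 'rV[R]_k) (r : R) : 0 < r ->
  exists q : 'rV[rat]_k, norm2 (y - map_mx ratr q) <= r.
Proof.
(* The norm is at most [k] times a bound on the coordinates; [k.+1] avoids a zero denominator. *)
move=> r0; pose e := r / k.+1%:R.
have e0 : 0 < e by rewrite divr_gt0 // ltr0n.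
have approx i : exists q : rat, `|y ord0 i - ratr q| < e.
  have /dense_rat : (ball (y ord0 i) e) !=set0 by exists (y ord0 i); exact: ballxx.
  case=> [|z [yq [q _ qE]]]; first exact: ball_open.
  by exists q; move: yq; rewrite -qE -ball_normE.
have [f fP] := choice approx.
exists (\row_i f i); apply: (@le_trans _ _ (k%:R * e)).
  by apply: norm2_le_coord => [|i]; rewrite ?ltW // !mxE.
by rewrite /e mulrCA ler_piMr ?(ltW r0) // ler_pdivrMr ?ltr0n // mul1r ler_nat.
Qed.

(** A point outside the support has a null ball around it, which contains a smaller ball with
    rational centre and radius [1 / (m + 1)] covering the point. There are only countably many of
    these. *)
Lemma negligible_supp (nu : probability (borel_rV R k) R) :
  nu.-negligible (~` supp nu).
Proof.
pose ball (q : 'rV[rat]_k) (m : nat) : set (borel_rV R k) :=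
  cball2 (map_mx ratr q) m.+1%:R^-1.
pose U (n : nat) : set (borel_rV R k) :=
  if unpickle n is Some (q, m) then
    if nu (ball q m) == 0%E then ball q m else set0 else set0.
apply: (@negligibleS _ _ _ _ (\bigcup_n U n)); last first.
  apply: negligible_bigcup => n; rewrite /U.
  case: (unpickle n) => [[q m]|]; last exact: negligible_set0.
  case: ifPn => [/eqP b0|_]; last exact: negligible_set0.
  by exists (ball q m); split=> //; exact: measurable_cball2.
move=> y /existsNP[r /not_implyP[r0 /negP]]; rewrite -leNgt => yr0.
have [m mr] : exists m : nat, m.+1%:R^-1 <= r / 2.
  have r2 : 0 < r / 2 by rewrite divr_gt0.
  exists (Num.bound (r / 2)^-1); rewrite -[leRHS]invrK.
  rewrite lef_pV2 ?posrE ?invr_gt0 ?ltr0n //.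
  have := @archi_boundP R (r / 2)^-1; rewrite invr_ge0 ltW // => /(_ isT) /ltW.
  by move=> /le_trans; apply; rewrite ler_nat leqnSn.
have m0 : (0 : R) < m.+1%:R^-1 by rewrite invr_gt0 ltr0n.
have [q yq] := rat_norm2_dense y m0.
exists (pickle (q, m)) => //; rewrite /U pickleK.
have b0 : nu (ball q m) = 0%E.
  apply/eqP; rewrite eq_le measure_ge0 andbT; apply: le_trans yr0.
  apply: le_measure; rewrite ?inE; [exact: measurable_cball2..|].
  move=> z; rewrite /ball /cball2 /= => zq.
  apply: le_trans (ler_norm2_dist (map_mx ratr q) _ _) _.
  rewrite (norm2B (map_mx ratr q)); apply: le_trans (lerD zq yq) _.
  by rewrite (splitr r) lerD.
by rewrite b0 eqxx.
Qed.

End Support.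

(** * Counting paths and deterministic dynamics *)

Section Counting.
Context {R : realType}.
Implicit Types (n : R -> nat) (q r s t : R).

Definition counting_path n : Prop :=
  (forall s t, 0 <= s -> s <= t -> (n s <= n t)%N) /\
  (forall t, 0 <= t -> \forall s \near t^'+, n s = n t).

Lemma counting_add n1 n2 : counting_path n1 -> counting_path n2 ->
  counting_path (fun t => n1 t + n2 t)%N.
Proof.
move=> [m1 r1] [m2 r2]; split=> [s t s0 st|t t0].
  by rewrite leq_add ?m1 ?m2.
by apply: filterS2 (r1 _ t0) (r2 _ t0) => s -> ->.
Qed.

Lemma counting_const n s q t : counting_path n -> 0 <= s -> s <= q -> q <= t ->
  n s = n t -> n q = n t.
Proof.
move=> [mono _] s0 sq qt st; apply/eqP; rewrite eqn_leq.
by rewrite mono ?(le_trans s0) //= -st mono.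
Qed.

Lemma no_event n s t r : counting_path n -> 0 <= s -> n s = n t ->
  s < r -> r <= t -> ~ event_at n r.
Proof.
move=> [mono _] s0 st sr rt [r0 /(_ _ s0 sr)]; rewrite ltnNge st => /negP; apply.
by apply: mono => //; exact: ltW.
Qed.

(** Take the infimum of the times from [s] on at which the final value is held. Right continuity
    shows that it is attained, and minimality makes it an event. *)
Lemma last_event n s t : counting_path n -> 0 <= s -> s <= t -> (n s < n t)%N ->
  exists r, [/\ s < r, r <= t, event_at n r & n r = n t].
Proof.
move=> [mono rc] s0 st nst.
pose S := [set q | s <= q /\ n q = n t].
have St : S t by [].
have lbS : lbound S s by move=> q [].
have hS : has_inf S by split; [exists t|exists s].
have sr : s <= inf S by apply: lb_le_inf => //; exists t.
have rt : inf S <= t by apply: ge_inf => //; exists s.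
have r0 := le_trans s0 sr.
have nr : n (inf S) = n t.
  have [e /= e0 he] := rc _ r0.
  have [q [sq qt] qe] := inf_adherent e0 hS.
  have : inf S <= q by apply: ge_inf => //; exists s.
  rewrite le_eqVlt => /predU1P[->//|rq]; rewrite -(he q) //=.
  by rewrite ltr_distl; apply/andP; split; [lra|lra].
have {}sr : s < inf S.
  rewrite lt_neqAle sr andbT; apply: contraTneq nst => ->.
  by rewrite nr ltnn.
exists (inf S); split=> //; split=> [|q q0 qr]; first exact: le_lt_trans sr.
have [sq|qs] := leP s q; last first.
  by rewrite nr (leq_ltn_trans _ nst) // mono // ltW.
rewrite ltn_neqAle (mono _ _ q0 (ltW qr)) andbT nr; apply/eqP => nqt.
have : inf S <= q by apply: ge_inf; [exists s|split].
by rewrite leNgt qr.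
Qed.

(** If neither path jumped at [r], both would be constant up to [r] from the later of two earlier
    times on, and so would their sum. *)
Lemma event_at_add n1 n2 r : counting_path n1 -> counting_path n2 ->
  event_at (fun t => n1 t + n2 t)%N r -> event_at n1 r \/ event_at n2 r.
Proof.
move=> [m1 _] [m2 _] [r0 er].
have [e1|/existsNP[s1]] :=
  pselect (forall s, 0 <= s -> s < r -> (n1 s < n1 r)%N); first by left.
move=> /not_implyP[s10 /not_implyP[s1r /negP]]; rewrite -leqNgt => h1.
right; split=> // s2 s20 s2r; rewrite ltnNge; apply/negP => h2.
have s0 : 0 <= Num.max s1 s2 by rewrite le_max s10.
have sr : Num.max s1 s2 < r by rewrite gt_max s1r.
have := er _ s0 sr; rewrite ltnNge => /negP; apply; apply: leq_add.
  by apply: leq_trans h1 _; rewrite m1 // le_max lexx.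
by apply: leq_trans h2 _; rewrite m2 // le_max lexx orbT.
Qed.

End Counting.

(** * Opinions along a path of the dynamics *)

Section Paths.
Context {R : realType} {k : nat}.
Variables (mu theta : R) (N : int -> R -> nat) (x : R -> int -> 'rV[R]_k).
Hypotheses (N_counting : forall e, counting_path (N e)) (N_0 : forall e, N e 0 = 0%N).
Hypothesis path : deffuant_path mu theta N x.
Implicit Types (q r s t : R) (o v : int).

Lemma opinion_const v s t : 0 <= s -> s <= t ->
  N (v - 1) s = N (v - 1) t -> N v s = N v t -> x t v = x s v.
Proof.
move=> s0 st e1 e2; apply: (path_constant path) => // r sr rt.
by split; [exact: no_event e1 sr rt|exact: no_event e2 sr rt].
Qed.

(* Induction on the number of events in the cluster, tracing an opinion back to
   the last event on an adjacent edge. *)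
Lemma opinion_invariant (D : set 'rV[R]_k) o (L : nat) t : 0 <= t ->
  (forall r (g : R -> 'rV[R]_k) a, (\forall q \near r^'-, D (g q)) ->
     g q @[q --> r^'-] --> a -> D a) ->
  (forall a b, D a -> D b -> D (interact mu theta a b)) ->
  N o t = 0%N -> N (o + L%:Z) t = 0%N ->
  (forall j, (1 <= j <= L)%N -> D (x 0 (o + j%:Z))) ->
  forall j, (1 <= j <= L)%N -> D (x t (o + j%:Z)).
Proof.
move=> t0 Dlim Dint Nleft Nright D0.
pose tot s := (\sum_(i < L) N (o + i%:Z) s)%N.
have tot_lt q r i : 0 <= q -> q <= r -> (i < L)%N ->
    (N (o + i%:Z) q < N (o + i%:Z) r)%N -> (tot q < tot r)%N.
  move=> q0 qr iL lt_i; rewrite /tot (bigD1 (Ordinal iL)) //=.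
  rewrite [ltnRHS](bigD1 (Ordinal iL)) //= -addSn.
  apply: leq_add => //; apply: leq_sum => j _.
  by have [m _] := N_counting (o + j%:Z); exact: m.
suff claim m s : 0 <= s -> s <= t -> (tot s < m)%N ->
    forall j, (1 <= j <= L)%N -> D (x s (o + j%:Z)) by exact: claim (leqnn _).
elim: m s => [//|m IH] s s0 st tots [//|j] jL.
have cnt := counting_add (N_counting (o + j%:Z)) (N_counting (o + j.+1%:Z)).
have prevE : o + j.+1%:Z - 1 = o + j%:Z by lia.
have const r : 0 <= r -> r <= s ->
    (N (o + j%:Z) r + N (o + j.+1%:Z) r = N (o + j%:Z) s + N (o + j.+1%:Z) s)%N ->
    x s (o + j.+1%:Z) = x r (o + j.+1%:Z).
  move=> r0 rs Nrs; have [m1 _] := N_counting (o + j%:Z).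
  have [m2 _] := N_counting (o + j.+1%:Z).
  have := m1 _ _ r0 rs; have := m2 _ _ r0 rs.
  by move=> ? ?; apply: opinion_const; rewrite ?prevE //; lia.
have [n0|n0] := posnP (N (o + j%:Z) s + N (o + j.+1%:Z) s)%N.
  by rewrite (const 0) ?N_0 ?n0 //; exact: D0.
(* The last event on either edge at the vertex fixes its opinion until [s]. *)
have [|r [r0 rs er nr]] := last_event cnt (lexx 0) s0; first by rewrite !N_0.
rewrite (const r) ?(ltW r0) //.
have [i iL [ei ij]] : exists2 i, (i <= L)%N &
    event_at (N (o + i%:Z)) r /\ (j.+1 = i \/ j.+1 = i.+1).
  have [ej|ej] := event_at_add (N_counting _) (N_counting _) er.
    by exists j; [lia|split=> //; right].
  by exists j.+1; [lia|split=> //; left].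
have Ni : (0 < N (o + i%:Z) t)%N.
  apply: (@leq_trans (N (o + i%:Z) r)).
    by have [_ /(_ 0 (lexx _) r0)] := ei; rewrite N_0.
  by have [m1 _] := N_counting (o + i%:Z); rewrite m1 ?(ltW r0) // (le_trans rs).
have i0 : (0 < i)%N.
  (* The end edges [o] and [o + L] are idle, so both endpoints of the event lie in the cluster. *)
  by rewrite lt0n; apply/eqP => i0; move: Ni; rewrite i0 addr0 Nleft.
have {}iL : (i < L)%N.
  rewrite ltn_neqAle iL andbT; apply/eqP => iL'.
  by move: Ni; rewrite iL' Nright.
have iE : o + i%:Z + 1 = o + i.+1%:Z by lia.
have [a [b [xa xb xra xrb]]] := path_update path ei.
rewrite iE in xb xrb.
(* Before [r] the total [tot] is smaller, as the event at [r] is not yet counted, so the induction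
   hypothesis applies. *)
have before j' : (1 <= j' <= L)%N -> \forall q \near r^'-, D (x q (o + j'%:Z)).
  move=> j'L; near=> q.
  have q0 : 0 <= q by apply: ltW; near: q; exact: nbhs_left_gt.
  have qr : q < r by near: q; exact: nbhs_left_lt.
  apply: IH => //; first by rewrite (le_trans (ltW qr)) // (le_trans rs).
  rewrite -ltnS; apply: leq_trans tots; rewrite ltnS.
  have [_ /(_ q q0 qr) lt_i] := ei.
  apply: leq_trans (tot_lt _ _ _ q0 (ltW qr) iL lt_i) _.
  by apply: leq_sum => i' _; have [m1 _] := N_counting (o + i'%:Z); rewrite m1 // ltW.
have Da : D a by apply: Dlim xa; apply: before; lia.
have Db : D b by apply: Dlim xb; apply: before; lia.
by case: ij => ->; rewrite ?xra ?xrb; exact: Dint.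
Unshelve. all: by end_near.
Qed.

(** There is a single event on the edges touching the block, the end edges [0] and [n] included. Its
    left limits are therefore the values at [s], and its result persists until [t]. *)
Lemma opinion_step o (n e : nat) s t : 0 <= s -> s <= t -> (1 <= e < n)%N ->
  (forall i, (i <= n)%N -> N (o + i%:Z) t = (N (o + i%:Z) s + (e == i))%N) ->
  forall j, (1 <= j <= n)%N ->
    x t (o + j%:Z) = edge_update mu theta (fun i => x s (o + i%:Z)) e j.
Proof.
move=> s0 st en Nst.
have prevE j : (1 <= j)%N -> o + j%:Z - 1 = o + j.-1%:Z by lia.
have [|r [sr rt er Nr]] := last_event (N_counting (o + e%:Z)) s0 st.
  by rewrite Nst ?eqxx; lia.
have eE : o + e%:Z + 1 = o + e.+1%:Z by lia.
have r0 : 0 <= r by exact: ltW (le_lt_trans s0 sr).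
have [a [b []]] := path_update path er; rewrite eE => xa xb xra xrb.
have same i q : (i <= n)%N -> i != e -> s <= q -> q <= t ->
    N (o + i%:Z) q = N (o + i%:Z) t.
  move=> iln ie sq qt; apply: (counting_const (N_counting _) s0) => //.
  by rewrite Nst // eq_sym (negbTE ie) addn0.
have before q : s <= q -> q < r -> N (o + e%:Z) q = N (o + e%:Z) s.
  move=> sq qr; have [mono _] := N_counting (o + e%:Z).
  have := mono _ _ s0 sq; have [_ /(_ q (le_trans s0 sq) qr)] := er.
  by rewrite Nr Nst ?eqxx; lia.
have const j q : (1 <= j <= n)%N -> s <= q -> q < r ->
    x q (o + j%:Z) = x s (o + j%:Z).
  move=> jn sq qr; have qt : q <= t := le_trans (ltW qr) rt.
  have eqN i : (i <= n)%N -> N (o + i%:Z) s = N (o + i%:Z) q.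
    move=> iln; have [->|ie] := eqVneq i e; first by rewrite before.
    by rewrite !same.
  by apply: opinion_const; rewrite ?prevE ?eqN //; lia.
have limE j c : (1 <= j <= n)%N -> x q (o + j%:Z) @[q --> r^'-] --> c ->
    c = x s (o + j%:Z).
  move=> jn xc; apply: cvg_unique xc _; first exact: norm_hausdorff.
  apply: cvg_near_cst; near=> q.
  have sq : s <= q by apply: ltW; near: q; exact: nbhs_left_gt.
  have qr : q < r by near: q; exact: nbhs_left_lt.
  exact: const.
have aE : a = x s (o + e%:Z) by apply: limE xa; lia.
have bE : b = x s (o + e.+1%:Z) by apply: limE xb; lia.
have after j : (1 <= j <= n)%N -> x t (o + j%:Z) = x r (o + j%:Z).
  move=> jn.
  have eqN i : (i <= n)%N -> N (o + i%:Z) r = N (o + i%:Z) t.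
    move=> iln; have [->|ie] := eqVneq i e; first by rewrite Nr.
    by rewrite same // ltW.
  by apply: opinion_const; rewrite ?prevE ?eqN //; lia.
move=> j jn; case: edge_updateP jn => [jn|jn|{}j je je1 jn].
- by rewrite after // xra aE bE.
- by rewrite after // xrb aE bE.
- apply: opinion_const => //.
    by rewrite prevE ?same //; lia.
  by rewrite same //; case/andP: jn.
Unshelve. all: by end_near.
Qed.

(** Each meeting has its own cell in a grid of mesh [h]. The additional idle cell at the end lets
    the final time be positive even when [es] is empty. *)
Lemma opinion_follows o (n : nat) (es : seq nat) h : 0 <= h ->
  (forall e, e \in es -> (1 <= e < n)%N) ->
  (forall e i, (e <= n)%N -> (i <= (size es).+1)%N ->
     N (o + e%:Z) (i%:R * h) = count_mem e (take i es)) ->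
  forall j, (1 <= j <= n)%N -> x ((size es).+1%:R * h) (o + j%:Z) =
    foldl (edge_update mu theta) (fun i => x 0 (o + i%:Z)) es j.
Proof.
move=> h0 esn Nes.
have ih0 i : 0 <= i%:R * h by rewrite mulr_ge0.
have ihS i : i%:R * h <= i.+1%:R * h by rewrite ler_wpM2r // ler_nat.
have follows i : (i <= size es)%N -> forall j, (1 <= j <= n)%N ->
    x (i%:R * h) (o + j%:Z) =
    foldl (edge_update mu theta) (fun i => x 0 (o + i%:Z)) (take i es) j.
  elim: i => [|i IH] ies j jn; first by rewrite mul0r take0.
  have en : (1 <= nth 0%N es i < n)%N by apply: esn; rewrite mem_nth.
  rewrite (take_nth 0%N) // foldl_rcons.
  rewrite (@opinion_step o n (nth 0%N es i) _ _ (ih0 i) (ihS i)) //; last first.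
    move=> i' i'n; rewrite !Nes //; try lia.
    by rewrite (take_nth 0%N) // -cats1 count_cat /= addn0.
  have xe i' : (1 <= i' <= n)%N -> _ := IH (ltnW ies) i'.
  have x1 := xe (nth 0%N es i); have x2 := xe (nth 0%N es i).+1.
  case: edge_updateP jn => [jn|jn|{}j je je1 jn].
  - by rewrite edge_update_left /= x1 ?x2 //; lia.
  - by rewrite edge_update_right /= x1 ?x2 //; lia.
  - by rewrite edge_update_other /= ?xe.
move=> j jn; have := follows _ (leqnn _) j jn; rewrite take_size => <-.
have prevE : o + j%:Z - 1 = o + j.-1%:Z by lia.
have eqN e : (e <= n)%N ->
    N (o + e%:Z) ((size es)%:R * h) = N (o + e%:Z) ((size es).+1%:R * h).
  by move=> en; rewrite !Nes // take_size take_oversize.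
by apply: opinion_const; rewrite ?prevE ?eqN //; lia.
Qed.

End Paths.

(** * Probability estimates *)

Section ProbabilityFacts.
Context {R : realType} {d : measure_display} {Omega : measurableType d}.
Variable P : probability Omega R.

Lemma ae_prob_gt0 (A B : set Omega) : measurable A -> measurable B ->
  (0 < P A)%E -> {ae P, forall w, A w -> B w} -> (0 < P B)%E.
Proof.
move=> mA mB PA AB; rewrite lt0e measure_ge0 andbT; apply/eqP => PB.
move: PA; rewrite (@measure_negligible _ _ _ P) ?ltxx //.
apply: (@negligibleS _ _ _ _ (~` [set w | A w -> B w] `|` B)).
  move=> w Aw; have [Bw|nBw] := pselect (B w); [by right|left].
  by move=> /(_ Aw).
by apply: negligibleU => //; exists B; split.
Qed.

Lemma ae_exists (A : set Omega) (Q : Omega -> Prop) : measurable A ->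
  (0 < P A)%E -> {ae P, forall w, Q w} -> exists2 w, A w & Q w.
Proof.
move=> mA PA aeQ; apply: contrapT => no.
suff : (0 < P set0)%E by rewrite measure0 ltxx.
apply: (ae_prob_gt0 mA _ PA) => //.
by apply: filterS aeQ => w Qw Aw; apply: no; exists w.
Qed.

Lemma prode_gt0 (I : eqType) (s : seq I) (F : I -> \bar R) :
  (forall i, i \in s -> 0 < F i)%E -> (0 < \big[*%E/1%E]_(i <- s) F i)%E.
Proof.
move=> F0; rewrite big_seq_cond.
elim/big_ind : _ => [|x y|i /andP[is_ _]]; [exact: lte01|exact: mule_gt0|exact: F0].
Qed.

Lemma poisson_pmf_gt0 (rate : R) m : 0 < rate -> 0 < poisson_pmf rate m.
Proof.
move=> rate0; rewrite /poisson_pmf rate0 mulr_gt0 ?expR_gt0 //.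
by rewrite divr_gt0 ?exprn_gt0 // ltr0n fact_gt0.
Qed.

End ProbabilityFacts.

(** * A single Poisson clock *)

Section Clock.
Context {R : realType} {d : measure_display} {Omega : measurableType d}.
Variables (P : probability Omega R) (N : R -> Omega -> nat).
Hypothesis poissonN : unit_poisson_process P N.

Lemma clock_counting w : counting_path (N ^~ w).
Proof.
split=> [s t s0 st|t t0]; first exact: (poisson_nondecreasing poissonN).
exact: (poisson_right_continuous poissonN).
Qed.

Lemma sigma_process_count t m : 0 <= t -> sigma_process N (N t @^-1` [set m]).
Proof.
move=> t0; apply: sub_sigma_algebra; exists t => //.
by exists [set m] => //; rewrite setTI.
Qed.

Lemma measurable_count t m : 0 <= t -> measurable (N t @^-1` [set m]).
Proof.
move=> t0; rewrite -[X in measurable X]setTI.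
exact: (poisson_measurable poissonN).
Qed.

Definition prescribed_counts (h : R) (m : nat) (c : nat -> nat) : set Omega :=
  \bigcap_(i in [set i | (i <= m)%N]) (N (i%:R * h) @^-1` [set c i]).

Lemma sigma_process_prescribed h m c :
  0 <= h -> sigma_process N (prescribed_counts h m c).
Proof.
move=> h0; apply: (@bigcap_measurableType _ (g_sigma_algebraType
  (\bigcup_(t in [set t : R | 0 <= t]) g_sigma_algebra_preimage (N t)))) => i _.
by apply: sigma_process_count; rewrite mulr_ge0.
Qed.

Lemma measurable_prescribed h m c :
  0 <= h -> measurable (prescribed_counts h m c).
Proof.
move=> h0; apply: bigcap_measurableType => i _.
by apply: measurable_count; rewrite mulr_ge0.
Qed.

(** Since the clock starts at zero, prescribing counts amounts to prescribing increments; these are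
    independent, and every Poisson weight is positive. *)
Lemma prescribed_counts_gt0 h m c : 0 < h -> c 0%N = 0%N ->
  (forall i, (c i <= c i.+1)%N) -> (0 < P (prescribed_counts h m c))%E.
Proof.
move=> h0 c0 cS; pose T (i : nat) : R := i%:R * h.
have T0 i : 0 <= T i by rewrite mulr_ge0 // ltW.
have TS i : T i < T i.+1 by rewrite ltr_pM2r // ltr_nat.
pose B i := [set w | (N (T i.+1) w - N (T i) w)%N = (c i.+1 - c i)%N].
have -> : prescribed_counts h m c =
    \bigcap_(i in [set` [fset i in iota 0 m]%fset]) B i.
  apply/seteqP; split=> w /= hw.
    move=> i /=; rewrite in_fset mem_iota /= add0n => im.
    by rewrite /B /= (hw i.+1 im) (hw i (ltnW im)).
  elim=> [_|i IH im] /=; first by rewrite mul0r (poisson_start poissonN) c0.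
  have := hw i; rewrite /= in_fset mem_iota add0n => /(_ im); rewrite /B /=.
  have := IH (ltnW im); rewrite /= -!/(T _) => ->.
  (* The subtraction in [B] is truncated: monotonicity of the clock and of [c] recovers the next
     count. *)
  have := poisson_nondecreasing poissonN w (T0 i) (ltW (TS i)).
  have := cS i; have := IH (ltnW im); rewrite /= -!/(T _) => ->; lia.
rewrite (poisson_independent_increments poissonN (t := T)) //.
- apply: prode_gt0 => i _.
  rewrite (poisson_increment poissonN) // lte_fin poisson_pmf_gt0 //.
  by rewrite subr_gt0.
- by move=> i; exact: ltW.
- by move=> i _; exists [set (c i.+1 - c i)%N] => //; rewrite setTI.
Qed.

Lemma no_count_prob t : 0 < t ->
  P (N t @^-1` [set 0%N]) = (poisson_pmf t 0)%:E.
Proof.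
move=> t0; rewrite -{2}[t]subr0 -(poisson_increment poissonN) //.
by congr (P _); apply/seteqP; split=> w /=;
  rewrite (poisson_start poissonN) subn0.
Qed.

End Clock.

(** * Almost sure properties and prescribed schedules in the model *)

Section Model.
Context {R : realType} {k : nat} {d : measure_display} {Omega : measurableType d}.
Variables (P : probability Omega R) (mu theta : R).
Variable nu : probability (borel_rV R k) R.
Variables (N : int -> R -> Omega -> nat) (eta : R -> int -> Omega -> borel_rV R k).
Hypothesis model : deffuant_model mu theta P nu N eta.

Let poissonN := deffuant_poisson model.

(** By independence, [m] distinct clocks have all rung by time [t] with probability [q ^+ m], which
    tends to zero. *)
Lemma ae_idle_clock (f : nat -> int) t : injective f -> 0 < t ->
  {ae P, forall w, exists j, N (f j) t w = 0%N}.
Proof.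
move=> f_inj t0; have t0' := ltW t0; pose q := 1 - poisson_pmf t 0.
pose busy u := ~` (N u t @^-1` [set 0%N]).
have mbusy u : measurable (busy u).
  by apply: measurableC; exact: (measurable_count (poissonN u)).
have Pbusy u : P (busy u) = q%:E.
  rewrite probability_setC; last exact: (measurable_count (poissonN u)).
  by rewrite (no_count_prob (poissonN u)).
have q1 : q < 1 by rewrite /q ltrBlDr ltrDl poisson_pmf_gt0.
have q0 : 0 <= q by rewrite -lee_fin -(Pbusy 0) measure_ge0.
have Pall m : P (\bigcap_(j in [set j | (j < m)%N]) busy (f j)) = (q ^+ m)%:E.
  pose s : seq (int + int) := [seq inr (f j) | j <- iota 0 m].
  pose A (i : int + int) := if i is inr u then busy u else setT.
  have us : uniq s by rewrite map_inj_uniq ?iota_uniq // => i j [] /f_inj.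
  have -> : \bigcap_(j in [set j | (j < m)%N]) busy (f j) =
      \bigcap_(i in [set` [fset i in s]%fset]) A i.
    apply/seteqP; split=> w hw.
      move=> i /=; rewrite in_fset => /mapP[j]; rewrite mem_iota add0n => jm -> /=.
      exact: hw.
    move=> j /= jm; apply: (hw (inr (f j))) => /=.
    by rewrite in_fset map_f // mem_iota.
  rewrite (deffuant_independent model) => [|[u|u] _ /=]; last first.
  - apply: (@measurableC _ (g_sigma_algebraType (\bigcup_(t in [set t : R | 0 <= t])
      g_sigma_algebra_preimage (N u t)))).
    exact: sigma_process_count.
  - by exists setT => //; rewrite setTI.
  rewrite (eq_big_seq (fun=> q%:E)) => [|i]; last first.
    by rewrite in_fset => /mapP[j _ ->] /=; exact: Pbusy.
  rewrite prodEFin; congr (_%:E).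
  rewrite big_const_seq count_predT iter_mulr_1 card_fseq undup_id //.
  by rewrite size_map size_iota.
pose Z := \bigcap_j busy (f j).
have mZ : measurable Z by exact: bigcapT_measurable.
exists Z; split=> //; last first.
  move=> w hw j _ /= Nj; apply: hw; by exists j.
have PZ m : (P Z <= (q ^+ m)%:E)%E.
  rewrite -Pall le_measure ?inE //; first exact: bigcap_measurableType.
  by move=> w hw j _; exact: hw.
apply/eqP; rewrite -measure_le0; apply/lee_addgt0Pr => e e0; rewrite add0e.
have qn : `|q| < 1 by rewrite ger0_norm.
have [m _ /(_ m (leqnn _)) /= qe] := cvgr_lt _ (cvg_expr qn) _ e0.
by apply: le_trans (PZ m) _; rewrite lee_fin ltW.
Qed.

(** A countable intersection of almost sure events, with the vertices coded as naturals. *)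
Lemma ae_initial_supp : {ae P, forall w, forall u, supp nu (eta 0 u w)}.
Proof.
have one u : {ae P, forall w, supp nu (eta 0 u w)}.
  have [B [mB nuB sB]] := negligible_supp nu.
  exists (eta 0 u @^-1` B); split.
  - rewrite -[X in measurable X]setTI.
    exact: (deffuant_measurable model u (lexx 0)).
  - by rewrite -nuB -(deffuant_initial_law model u mB).
  - by move=> w; exact: sB.
have := @ae_foralln _ _ _ P
  (fun n w => if unpickle n is Some u then supp nu (eta 0 u w) else True).
move=> /(_ _)[n|B [mB PB sB]].
  case: (unpickle n) => [u|]; first exact: one.
  by exists set0; split=> // w [].
exists B; split=> // w nw; apply: sB => hw; apply: nw => u.
by have := hw (pickle u); rewrite pickleK.
Qed.

(** The edges [0] and [n] are constrained as well: when [es] stays inside the path they must be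
    idle, which isolates the block. *)
Definition scheduled (o : int) (n : nat) (xi : nat -> 'rV[R]_k) (es : seq nat)
    (delta h : R) :
  set Omega := [set w |
    (forall j, (1 <= j <= n)%N -> norm2 (eta 0 (o + j%:Z) w - xi j) <= delta) /\
    (forall e i, (e <= n)%N -> (i <= (size es).+1)%N ->
       N (o + e%:Z) (i%:R * h) w = count_mem e (take i es))].

Lemma scheduled_gt0 (o : int) n xi es delta h : 0 < delta -> 0 < h ->
  (forall j, (1 <= j <= n)%N -> supp nu (xi j)) ->
  measurable (scheduled o n xi es delta h) /\
  (0 < P (scheduled o n xi es delta h))%E.
Proof.
move=> delta0 h0 xis; have h0' := ltW h0.
(* The absolute value recovers the position in the path; only [u >= o] occurs in [s]. *)
pose c (u : int) i := count_mem `|u - o|%N (take i es).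
pose s : seq (int + int) := [seq inl (o + j%:Z) | j <- iota 1 n] ++
  [seq inr (o + e%:Z) | e <- iota 0 n.+1].
pose A (i : int + int) : set Omega := match i with
  | inl u => eta 0 u @^-1` (cball2 (xi `|u - o|%N) delta)
  | inr u => prescribed_counts (N u) h (size es).+1 (c u)
  end.
have absE (j : nat) : `|(o + j%:Z - o)%R|%N = j by lia.
have EA : scheduled o n xi es delta h = \bigcap_(i in [set` [fset i in s]%fset]) A i.
  apply/seteqP; split=> w.
    move=> [xiw Nw] i /=; rewrite in_fset mem_cat => /orP[]/mapP[j].
      rewrite mem_iota => jn -> /=; rewrite absE; apply: xiw; lia.
    rewrite mem_iota add0n => jn -> i' /= i's.
    by rewrite /c absE; apply: Nw.
  move=> hw; split=> [j jn|e i en ie].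
    have := hw (inl (o + j%:Z)); rewrite /= absE; apply.
    by rewrite in_fset mem_cat map_f // mem_iota; lia.
  have := hw (inr (o + e%:Z)); rewrite /= /prescribed_counts /= => /(_ _ i ie).
  rewrite /= /c absE; apply.
  rewrite in_fset mem_cat (map_f (fun e : nat => inr (o + e%:Z))) ?orbT //.
  by rewrite mem_iota; lia.
have mA i : measurable (A i).
  case: i => u; last exact: (measurable_prescribed (poissonN u)).
  rewrite /= -[X in measurable X]setTI.
  by apply: (deffuant_measurable model u (lexx 0)) => //; exact: measurable_cball2.
rewrite EA; split.
  by apply: fin_bigcap_measurable => //; exact: finite_fset.
rewrite (deffuant_independent model) => [|[u|u] _ /=]; last first.
- exact: sigma_process_prescribed.
- by exists (cball2 (xi `|u - o|%N) delta); [exact: measurable_cball2|rewrite setTI].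
apply: prode_gt0 => i; rewrite in_fset mem_cat => /orP[]/mapP[j].
  rewrite mem_iota => jn -> /=; rewrite absE.
  rewrite [X in (0 < X)%E](_ : _ = nu (cball2 (xi j) delta)).
    by apply: xis delta0; lia.
  exact: (deffuant_initial_law model (o + j%:Z) (measurable_cball2 (xi j) delta)).
move=> _ -> /=; apply: (prescribed_counts_gt0 (poissonN _)) => //.
  by rewrite /c take0.
move=> i'; rewrite /c; have [ie|ie] := ltnP i' (size es).
  by rewrite (take_nth 0%N) // -cats1 count_cat leq_addr.
by rewrite !take_oversize // leqW.
Qed.

End Model.

(** * The two inclusions *)

Unset Implicit Arguments.

Theorem proposition3p8 (R : realType) (k : nat) (d : measure_display)
    (Omega : measurableType d) (P : probability Omega R)
    (mu theta : R) (nu : probability (borel_rV R k) R)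
    (N : int -> R -> Omega -> nat)
    (eta : R -> int -> Omega -> borel_rV R k)
    (hk : (1 <= k)%N) (hmu0 : 0 < mu) (hmu : mu <= 2%:R^-1) (htheta : 0 < theta)
    (hmodel : deffuant_model mu theta P nu N eta)
    (hnojump : exists eps : R, [/\ 0 < eps, eps < theta &
      forall s s' : R, theta - eps <= s <= theta + eps ->
        theta - eps <= s' <= theta + eps -> Dset mu nu s = Dset mu nu s']) :
  forall (t : R) (v : int), 0 < t ->
    supp (pushforward P (eta t v)) = Dset mu nu theta.
Proof.
move=> t v t0; have t0' := ltW t0.
have mu1 : mu < 1 by apply: le_lt_trans hmu _; lra.
have [eps [eps0 eps_theta nojump]] := hnojump.
have DplusE : Dset mu nu (theta + eps) = Dset mu nu theta.
  by apply: nojump; lra.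
have DminusE : Dset mu nu (theta - eps) = Dset mu nu theta.
  by apply: nojump; lra.
have mball x r : measurable (eta t v @^-1` cball2 x r).
  rewrite -[X in measurable X]setTI.
  by apply: (deffuant_measurable hmodel v t0') => //; exact: measurable_cball2.
have cnt w e : counting_path (fun s => N e s w).
  exact: (clock_counting (deffuant_poisson hmodel e)).
have start w e : N e 0 w = 0%N by exact: (poisson_start (deffuant_poisson hmodel e)).
apply/seteqP; split=> x.
  move=> xsupp.
  (* Constancy up to [theta + eps] absorbs the loss in [Dset_mix]. *)
  have Dint a b : Dset mu nu theta a -> Dset mu nu theta b ->
      Dset mu nu theta (interact mu theta a b).
    rewrite -DplusE /interact => Da Db; case: ifP => // ab.
    by apply: Dset_mix => //; exact: ltW.
  have aeD : {ae P, forall w, Dset mu nu theta (eta t v w)}.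
    have right_inj : injective (fun j : nat => v + j%:Z).
      by move=> i j /addrI [].
    have left_inj : injective (fun j : nat => v - 1 - j%:Z).
      by move=> i j /addrI /oppr_inj [].
    have aeR := ae_idle_clock hmodel right_inj t0.
    have aeL := ae_idle_clock hmodel left_inj t0.
    apply: filterS3 (filterI aeL aeR) (ae_initial_supp hmodel)
      (deffuant_dynamics hmodel) => w [[jl Nl] [jr Nr]] init path.
    (* The cluster lies between the idle edges [v - 1 - jl] and [v + jr], and [v] is its vertex
       number [jl.+1]. *)
    have := @opinion_invariant _ _ mu theta (fun e s => N e s w)
      (fun s u => eta s u w) (cnt w) (start w) path (Dset mu nu theta)
      (v - 1 - jl%:Z) (jl.+1 + jr) t t0' _ Dint Nl _ _ jl.+1.
    have -> : v - 1 - jl%:Z + jl.+1%:Z = v by lia.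
    apply.
    - by move=> r g a Dg ga; exact: Dset_lim Dg ga.
    - by rewrite (_ : v - 1 - jl%:Z + (jl.+1 + jr)%:Z = v + jr%:Z) //; lia.
    - by move=> j _; exact: supp_sub_Dset.
    - by rewrite /= leq_addr.
  (* Every ball around [x] is charged by the law of [eta t v], hence contains a point of the closed
     set [Dset mu nu theta]. *)
  apply: Dset_approx => r r0.
  by have [w wr Dw] := ae_exists (mball x r) (xsupp r r0) aeD; exists (eta t v w).
rewrite -DminusE => Dx r r0.
have r2 : 0 < r / 2 by rewrite divr_gt0.
have [n [x0 [es [[n1 x0s esn] x0r]]]] := Dx _ r2.
(* [r / 2] is the error left beside that of the configuration; [eps / 2] is the tolerance of its
   meetings. *)
pose delta := Num.min (r / 2) (eps / 2).
have delta0 : 0 < delta by rewrite lt_min r2 divr_gt0.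
have delta_eps : delta + delta <= eps.
  by rewrite [leRHS](splitr eps) lerD // ge_min lexx orbT.
have [es' es'n robust] := perturbed_configuration theta x0
  (ltW hmu0) (ltW mu1) delta_eps esn.
pose h := t / (size es').+1%:R.
have h0 : 0 < h by rewrite divr_gt0 // ltr0n.
have hE : (size es').+1%:R * h = t by rewrite mulrC divfK // pnatr_eq0.
(* The origin [v - 1] puts [v] at position 1 of the path. *)
have [mS PS] := scheduled_gt0 hmodel (v - 1) es' delta0 h0 x0s.
apply: (ae_prob_gt0 mS _ PS) => //.
apply: filterS (deffuant_dynamics hmodel) => w path [init clocks].
have := @opinion_follows _ _ mu theta (fun e s => N e s w)
  (fun s u => eta s u w) (cnt w) path (v - 1) n es' h (ltW h0) es'n clocks 1%N n1.
rewrite hE subrK => etaE; rewrite /cball2 /= etaE.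
apply: le_trans (ler_norm2_dist (foldl (edge_update mu (theta - eps)) x0 es 1%N) _ _) _.
rewrite [leRHS](splitr r) lerD //; last exact: x0r.
by apply: le_trans (robust _ init _ _) _; rewrite // ge_min lexx.
Qed.
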